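(* Let $m$ and $n$ be two positive integers with $n\ge m$, and let $P_n^{(0,0)}$ denote the Legendre polynomials. The coefficients $\rho_{j,n}^{m;(0,0)}$, $0\le j\le m+n+1$, in $$\int_{-1}^{x+1}P_m^{(0,0)}(x-t)P_n^{(0,0)}(t)\,dt=\sum_{j=0}^{m+n+1}\rho_{j,n}^{m;(0,0)}P_j^{(0,0)}(x+1)$$ can be expressed as $$\rho_{j,n}^{m;(0,0)}=\sum_{\nu=\max(1,|j-n|)}^{m+1}\varpi_{j,\nu}^{m,n}(0,0)\quad\text{for } j\ge\max(m+1,n-m-1),$$ $$\rho_{j,n}^{m;(0,0)}=0\quad\text{for } m+1\le j\le n-m-2,\ \text{if } n\ge2m+3,$$ $$\rho_{j,n}^{m;(0,0)}=\sum_{\nu=1}^j\varpi_{j,\nu}^{n,m}(0,0)+\sum_{\nu=j+1}^{n+1}d_{\nu,j,n}^m(0,0)\quad\text{for }0\le j\le m,$$ where $$\varpi_{j,\nu}^{m,n}(0,0)=\frac{(-1)^{m+\nu+1}(2j+1)(m+\nu-1)!\,(-\nu)_{\frac{n-j+\nu}{2}}}{4^\nu(\nu-1)!\,(m-\nu+1)!\left(\frac{n-j+\nu}{2}\right)!\left(\frac{n+j-\nu+1}{2}\right)_{\nu+1}}$$ for even $n+\nu-j$ and $\varpi_{j,\nu}^{m,n}(0,0)=0$ otherwise (with $\varpi_{j,\nu}^{n,m}$ obtained by interchanging $m$ and $n$ throughout, including in the parity condition), and $$d_{\nu,j,n}^m(0,0)=\frac{\sqrt\pi\,(2j+1)\,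\nu\,2^{j+m-\nu}(-1)^{m+\nu+n+1}(n+\nu-1)!\left(\frac{-j-m+\nu+1}{2}\right)_{j+m}\left(\frac{j-m+\nu+2}{2}\right)_m}{(n-\nu+1)!\,(j+m+\nu)!\,\Gamma\!\left(\frac{-j+m+\nu+2}{2}\right)\Gamma\!\left(\frac{j+m+\nu+3}{2}\right)}.$$
   Context: $(z)_0=1$ and $(z)_N=\prod_{\sigma=0}^{N-1}(z+\sigma)$ for $N\ge1$. $P_n^{(0,0)}$ is the Legendre polynomial of degree $n$ with the standard normalization $P_n^{(0,0)}(1)=1$. Empty sums are zero. *)

(* Defs.v *)
From HB Require Import structures.
From mathcomp Require Import all_boot all_order all_algebra.
From mathcomp Require Import all_classical all_reals all_analysis.

Set Implicit Arguments.
Unset Strict Implicit.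
Unset Printing Implicit Defensive.

Import Order.TTheory GRing.Theory Num.Theory.
Import numFieldNormedType.Exports.

Local Open Scope classical_set_scope.
Local Open Scope ring_scope.

(* Rising factorial z (z + 1) ... (z + N - 1). *)
Definition pochhammer (R : realType) (z : R) (N : nat) : R :=
  \prod_(s < N) (z + s%:R).

(* Rodrigues' formula; its constant is the one for which P_n(1) = 1. *)
Definition legendre (R : realType) (n : nat) : {poly R} :=
  (2 ^+ n * n`!%:R)^-1 *: (('X ^+ 2 - 1) ^+ n)^`(n).

(* Euler's integral. It represents Gamma for z > 0 only, which covers every
   argument occurring in [dcoef] when j + 1 <= nu. *)
Definition Gamma (R : realType) (z : R) : R :=
  \int[@lebesgue_measure R]_(t in `]0, +oo[) (t `^ (z - 1) * expR (- t)).

(* The integral from a to b, with the usual sign change when b < a. *)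
Definition oriented_integral (R : realType) (a b : R) (f : R -> R) : R :=
  if a <= b then \int[@lebesgue_measure R]_(t in `[a, b]) f t
  else - \int[@lebesgue_measure R]_(t in `[b, a]) f t.

(* The subtractions on nat are truncated; they agree with the integer ones when
   1 <= nu <= m + 1 and j <= n + nu. *)
Definition varpi (R : realType) (m n j nu : nat) : R :=
  if odd (n + nu - j) then 0
  else
    let k := ((n + nu - j)./2)%N in
    ((-1) ^+ (m + nu + 1) * (2 * j + 1)%:R * (m + nu - 1)`!%:R
       * pochhammer (- nu%:R) k)
    / (4 ^+ nu * (nu - 1)`!%:R * (m + 1 - nu)`!%:R * k`!%:R
       * pochhammer ((n%:R + j%:R - nu%:R + 1) / 2) (nu + 1)).

(* Likewise for 1 <= nu <= n + 1. The exponent of 2 may be negative. *)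
Definition dcoef (R : realType) (m n j nu : nat) : R :=
  (Num.sqrt pi * (2 * j + 1)%:R * nu%:R
     * 2 ^ (j%:Z + m%:Z - nu%:Z) * (-1) ^+ (m + nu + n + 1)
     * (n + nu - 1)`!%:R
     * pochhammer ((- j%:R - m%:R + nu%:R + 1) / 2) (j + m)
     * pochhammer ((j%:R - m%:R + nu%:R + 2) / 2) m)
  / ((n + 1 - nu)`!%:R * (j + m + nu)`!%:R
     * Gamma ((- j%:R + m%:R + nu%:R + 2) / 2)
     * Gamma ((j%:R + m%:R + nu%:R + 3) / 2)).

Definition is_legendre_convolution_expansion (R : realType) (m n : nat)
    (rho : nat -> R) : Prop :=
  forall x : R,
    oriented_integral (-1) (x + 1)
      (fun t => (legendre R m).[x - t] * (legendre R n).[t])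
    = \sum_(j < m + n + 2) rho j * (legendre R j).[x + 1].

(* Main.v *)
Require Import Defs.
From mathcomp Require Import all_boot all_order all_algebra.
From mathcomp Require Import all_classical all_reals all_analysis.
From mathcomp Require Import measurable_realfun.
From mathcomp Require Import ring lra zify.

(* Let I be integration from -1. Integrating by parts until the polynomial
   factor is exhausted turns the convolution into the sum over nu of
   P_m^(nu-1)(-1) I^nu P_n, and, by the symmetric choice, into the sum of
   P_n^(nu-1)(-1) I^nu P_m. The relation (2n+1) P_n = P_{n+1}' - P_{n-1}' makes
   I a two-term operator on Legendre coordinates; the coefficients of I^nu P_n
   then satisfy a recurrence in nu and n, solved in closed form by two
   hypergeometric products: one while the boundary term I P_0 = P_1 + P_0 plays
   no role (this gives varpi), and one for the indices j < nu (this gives d).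
   The Gamma factors of d only occur as a product
   Gamma((K+2)/2) Gamma((K+3)/2) times a rising factorial, evaluated through
   the moments of exp(-s^2). *)

Set Implicit Arguments.
Unset Strict Implicit.
Unset Printing Implicit Defensive.

Import Order.TTheory GRing.Theory Num.Theory.
Import numFieldNormedType.Exports.

Local Open Scope ring_scope.

(** * Legendre polynomials and their primitives *)

Section Legendre.
Variable R : realType.
Implicit Types (n k j nu : nat).

Lemma fact_natr_neq0 n : n`!%:R != 0 :> R.
Proof. by rewrite pnatr_eq0 -lt0n fact_gt0. Qed.

Lemma exp2_natr_neq0 n : 2 ^+ n != 0 :> R.
Proof. by rewrite expf_neq0 ?pnatr_eq0. Qed.

Let w : {poly R} := 'X ^+ 2 - 1.

Lemma deriv2_wexp n :
  (w ^+ n.+1)^`()^`() = (2 * (2 * n + 1) * n.+1)%:R *: w ^+ n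
                     + (4 * n.+1 * n)%:R *: w ^+ n.-1.
Proof.
have dw : w^`() = 2%:R *: 'X.
  by rewrite derivB derivXn derivC subr0 expr1 scaler_nat.
rewrite deriv_exp /= dw derivMn derivM derivZ derivX.
case: n => [|n]; rewrite -!mul_polyC !polyC_natr.
  by rewrite expr0 derivC mulr0 muln0 mul0r !mulr1 addr0.
rewrite deriv_exp /= dw -!mul_polyC !polyC_natr exprS.
by move: (w ^+ n) => W; rewrite /w; ring.
Qed.

(** The derivative of P_{n+1} is, up to its constant, the n-th derivative of (w^(n+1))''; by
    [deriv2_wexp] this splits into a multiple of P_n and a multiple of P_{n-1}'. For n = 0, [n.-1]
    is 0 and P_0' = 0 stands for the missing term. *)
Lemma legendre_deriv n :
  (2 * n + 1)%:R *: legendre R n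
  = (legendre R n.+1)^`() - (legendre R n.-1)^`().
Proof.
rewrite /legendre !derivZ -/w -!derivnS 2!derivSn deriv2_wexp.
rewrite derivnD !derivnZ scalerDr !scalerA exprS factS !natrM.
have f0 := fact_natr_neq0; have e0 := exp2_natr_neq0.
case: n => [|n] /=.
  rewrite fact0 expr0 derivC !(mulr0, scaler0, scale0r, addr0, subr0).
  by congr (_ *: _); field.
have n0 := ler0n R n.
rewrite !factS !natrM !(exprS 2) -[RHS]addrA -scalerBl.
rewrite [X in _ + X *: _](_ : _ = 0) ?scale0r ?addr0.
  congr (_ *: _); field; rewrite f0 e0 /=; apply/andP; split; lra.
by field; rewrite f0 e0 /=; lra.
Qed.

(** Only the Leibniz term in which every derivative hits the power of X - a survives at a. The
    induction absorbs one factor into [q], whose value at a is multiplied by n + 1. *)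
Lemma derivn_horner_root n (a : R) (q : {poly R}) :
  ((('X - a%:P) ^+ n * q)^`(n)).[a] = n`!%:R * q.[a].
Proof.
elim: n q => [|n IHn] q; first by rewrite expr0 !mul1r derivn0.
have -> : (('X - a%:P) ^+ n.+1 * q)^`(n.+1)
          = (('X - a%:P) ^+ n * (n.+1%:R *: q + ('X - a%:P) * q^`()))^`(n).
  rewrite derivSn derivM deriv_exp derivXsubC; congr (_^`(n)).
  by rewrite -mul_polyC polyC_natr exprS /=; ring.
rewrite IHn !hornerE subrr mul0r addr0 factS natrM; ring.
Qed.

Lemma legendre_m1 n : (legendre R n).[-1] = (-1) ^+ n.
Proof.
have -> : legendre R n = (2 ^+ n * n`!%:R)^-1 *: ((('X - (-1)%:P) ^+ n
   * ('X - 1) ^+ n)^`(n)).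
  rewrite /legendre -exprMn; congr (_ *: (_ ^+ _)^`(_)).
  by rewrite polyCN opprK expr2; ring.
rewrite hornerZ derivn_horner_root !hornerE /=.
rewrite (_ : -1 - 1 = (-1) * 2 :> R); last by ring.
rewrite exprMn; field.
by rewrite fact_natr_neq0 exp2_natr_neq0.
Qed.


Lemma legendre0 : legendre R 0 = 1.
Proof. by rewrite /legendre !expr0 derivn0 fact0 mulr1 invr1 scale1r. Qed.

Lemma derivnS_legendre0 k : (legendre R 0)^`(k.+1) = 0.
Proof. by rewrite legendre0 derivnC. Qed.

(* The subtraction is the one of R, hence the case n < k is included. *)
Lemma ffactSr_natr n k :
  (n ^_ k.+1)%:R = (n ^_ k)%:R * (n%:R - k%:R) :> R.
Proof.
rewrite ffactnSr natrM; have [kn|nk] := leqP k n; first by rewrite natrB.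
by rewrite ffact_small // !mul0r.
Qed.

(** Differentiating [legendre_deriv] k times and evaluating at -1 gives a recurrence in n and k. The
    falling factorial is (n + k)! / (n - k)!, and 0 when n < k, so no case distinction is needed. *)
Lemma derivn_legendre_m1 n k :
  ((legendre R n)^`(k)).[-1]
  = (-1) ^+ (n + k) * ((n + k) ^_ (2 * k))%:R / (2 ^+ k * k`!%:R).
Proof.
elim: k n => [|k IHk] n.
  by rewrite derivn0 legendre_m1 addn0 muln0 ffactn0 fact0 expr0; field.
elim/ltn_ind: n => -[|n] IHn.
  by rewrite derivnS_legendre0 horner0 ffact_small ?mulr0 ?mul0r //; lia.
have -> : ((legendre R n.+1)^`(k.+1)).[-1]
    = (2 * n + 1)%:R * ((legendre R n)^`(k)).[-1]
      + ((legendre R n.-1)^`(k.+1)).[-1].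
  by rewrite -hornerZ -derivnZ legendre_deriv derivnB !derivSn hornerD hornerN subrK.
(* Here n + k stands for (n - 1) + (k + 1); in this form the value is also right for n = 0, where
   both sides vanish. *)
have -> : ((legendre R n.-1)^`(k.+1)).[-1]
    = (-1) ^+ (n + k) * ((n + k) ^_ (2 * k.+1))%:R / (2 ^+ k.+1 * k.+1`!%:R).
  case: n IHn => [|n] IHn /=; last by rewrite IHn ?addnS ?addSn.
  by rewrite -derivnS derivnS_legendre0 horner0 ffact_small ?mulr0 ?mul0r //; lia.
rewrite IHk (_ : n.+1 + k.+1 = (n + k).+2)%N; last by lia.
rewrite mulnS add2n !ffactSS !ffactSr_natr factS !natrM !exprS.
by field; rewrite fact_natr_neq0 exp2_natr_neq0 /=; have := ler0n R k; lra.
Qed.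

(* Legendre coordinates of the primitive vanishing at -1. *)
Definition legendre_primitive (c : nat -> R) (j : nat) : R :=
  (if j is i.+1 then c i / (2 * i + 1)%:R else c 0%N) - c j.+1 / (2 * j + 3)%:R.

(** By [legendre_deriv] the sum telescopes, up to two boundary terms that vanish once c is zero from
    N on. The entry at j = 0 is invisible here, as P_0' = 0. *)
Lemma legendre_primitive_deriv c N :
  \sum_(j < N.+1) legendre_primitive c j *: (legendre R j)^`()
  = \sum_(j < N) c j *: legendre R j
    - (c N / (2 * N + 1)%:R) *: (legendre R N.-1)^`()
    - (c N.+1 / (2 * N + 3)%:R) *: (legendre R N)^`().
Proof.
have d0 : (legendre R 0)^`() = 0 by rewrite legendre0 derivC.
elim: N => [|N IHN].
  by rewrite big_ord_recl !big_ord0 /= d0 !scaler0; ring.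
rewrite big_ord_recr IHN [in RHS]big_ord_recr /=.
have n0 : (2 * N + 1)%:R != 0 :> R by rewrite pnatr_eq0 addn1.
have -> : c N *: legendre R N = (c N / (2 * N + 1)%:R)
    *: ((legendre R N.+1)^`() - (legendre R N.-1)^`()).
  by rewrite -legendre_deriv [RHS]scalerA divfK.
rewrite (_ : 2 * N.+1 + 1 = 2 * N + 3)%N; last by lia.
rewrite scalerBr scalerBl.
set A := (legendre R N.+1)^`(); set B := (legendre R N.-1)^`().
set S := \sum_(i < N) _; set C := (legendre R N)^`().
rewrite -!mul_polyC; ring.
Qed.

(** With P_j(-1) = (-1)^j the sum telescopes. This fixes the constant of integration, hence the
    special entry of [legendre_primitive] at j = 0. *)
Lemma legendre_primitive_m1 c N :
  \sum_(j < N.+1) legendre_primitive c j * (legendre R j).[-1]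
  = (-1) ^+ N * (c N / (2 * N + 1)%:R - c N.+1 / (2 * N + 3)%:R).
Proof.
elim: N => [|N IHN].
  rewrite big_ord_recl big_ord0 legendre_m1 /legendre_primitive !expr0 muln0.
  by rewrite !add0n /=; field.
rewrite big_ord_recr IHN /= legendre_m1 /legendre_primitive exprS.
by rewrite (_ : 2 * N.+1 + 1 = 2 * N + 3)%N; [ring|lia].
Qed.

(* The j-th Legendre coordinate of the nu-fold primitive of P_n. *)
Definition legendre_iter nu n : nat -> R :=
  iter nu legendre_primitive (fun j => (j == n)%:R).

(** Used to apply the innermost primitive to P_n first and to push the remaining ones through the
    resulting combination. *)
Lemma iter_legendre_primitive_lin nu a b (c d e : nat -> R) :
  (forall j, e j = a * c j + b * d j) ->
  forall j, iter nu legendre_primitive e j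
    = a * iter nu legendre_primitive c j + b * iter nu legendre_primitive d j.
Proof.
move=> ecd; elim: nu => //= nu IHnu j; rewrite {1}/legendre_primitive.
by rewrite !IHnu /legendre_primitive; case: j => [|j]; rewrite ?IHnu; ring.
Qed.

Lemma legendre_iterS0 nu j :
  legendre_iter nu.+1 0 j = legendre_iter nu 1 j + legendre_iter nu 0 j.
Proof.
rewrite /legendre_iter iterSr -[X in _ = X + _]mul1r -[X in _ = _ + X]mul1r.
apply: iter_legendre_primitive_lin => -[|[|i]].
- by rewrite /legendre_primitive /=; field.
- by rewrite /legendre_primitive /=; field.
- by rewrite /legendre_primitive /= !(mul0r, mulr0); ring.
Qed.

(** The relation (2n+3) I P_{n+1} = P_{n+2} - P_n, with nu further primitives applied to it. There
    is no constant term, since P_{n+2} and P_n agree at -1. *)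
Lemma legendre_iterSS nu n j :
  (2 * n + 3)%:R * legendre_iter nu.+1 n.+1 j
  = legendre_iter nu n.+2 j - legendre_iter nu n j.
Proof.
have n0 : (2 * n + 3)%:R != 0 :> R by rewrite pnatr_eq0 addn3.
rewrite /legendre_iter iterSr (@iter_legendre_primitive_lin nu
  (2 * n + 3)%:R^-1 (- (2 * n + 3)%:R^-1) (fun i => (i == n.+2)%:R)
  (fun i => (i == n)%:R)) => [|i]; first by field.
rewrite /legendre_primitive eqSS.
have -> : (if i is i'.+1 then (i' == n.+1)%:R / (2 * i' + 1)%:R
           else (0%N == n.+1)%:R) = (i == n.+2)%:R / (2 * n + 3)%:R :> R.
  case: i => [|i]; first by rewrite mul0r.
  rewrite eqSS; case: eqP => [->|]; last by rewrite !mul0r.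
  by rewrite (_ : 2 * n.+1 + 1 = 2 * n + 3)%N //; lia.
by case: (i =P n) => [->|_] /=; ring.
Qed.

Lemma legendre_iter_eq0 nu n j : (n + nu < j)%N -> legendre_iter nu n j = 0.
Proof.
elim: nu j => [|nu IHnu] j nj.
  by rewrite /legendre_iter /=; case: eqP => //; lia.
rewrite /legendre_iter iterS -/(legendre_iter nu n) /legendre_primitive.
case: j nj => [|j] nj; first by lia.
by rewrite !IHnu ?mul0r ?subr0 //; lia.
Qed.

Definition legendre_antideriv nu n : {poly R} :=
  \sum_(j < (n + nu).+1) legendre_iter nu n j *: legendre R j.

Lemma legendre_antideriv0 n : legendre_antideriv 0 n = legendre R n.
Proof.
rewrite /legendre_antideriv addn0 big_ord_recr /= /legendre_iter /= eqxx scale1r.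
by rewrite big1 ?add0r // => i _; rewrite (ltn_eqF (ltn_ord i)) scale0r.
Qed.

Lemma deriv_legendre_antideriv nu n :
  (legendre_antideriv nu.+1 n)^`() = legendre_antideriv nu n.
Proof.
rewrite /legendre_antideriv addnS raddf_sum /=.
under eq_bigr do rewrite derivZ.
rewrite legendre_primitive_deriv !(@legendre_iter_eq0 nu n) //.
by rewrite !mul0r !scale0r !subr0.
Qed.

Lemma legendre_antideriv_m1 nu n : (legendre_antideriv nu.+1 n).[-1] = 0.
Proof.
rewrite /legendre_antideriv addnS horner_sum.
under eq_bigr do rewrite hornerZ.
rewrite (legendre_primitive_m1 (legendre_iter nu n)) !(@legendre_iter_eq0 nu n) //.
by rewrite !mul0r subr0 mulr0.
Qed.

End Legendre.

(** * Closed forms for the coefficients of iterated primitives *)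

Section IteratedIntegrals.
Variable R : realType.
Implicit Types (n k j nu : nat).

Lemma pochhammerS (z : R) N : pochhammer z N.+1 = pochhammer z N * (z + N%:R).
Proof. by rewrite /pochhammer big_ord_recr. Qed.

Lemma pochhammerSl (z : R) N : pochhammer z N.+1 = z * pochhammer (z + 1) N.
Proof.
rewrite /pochhammer big_ord_recl addr0; congr (_ * _).
by apply: eq_bigr => i _; rewrite /= -addrA nat1r.
Qed.

Lemma pochhammer_gt0 (z : R) N : 0 < z -> 0 < pochhammer z N.
Proof. by move=> z0; apply: prodr_gt0 => i _; rewrite ltr_wpDr. Qed.

(** Turns the factor (-nu)_k / k! of [varpi] into a signed binomial coefficient, for which Pascal's
    rule is available. *)
Lemma pochhammerNn nu k :
  pochhammer (- nu%:R : R) k = (-1) ^+ k * k`!%:R * 'C(nu, k)%:R.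
Proof.
rewrite -mulrA -natrM mulnC bin_ffact.
elim: k => [|k IHk]; first by rewrite /pochhammer big_ord0 expr0 ffactn0 mulr1.
by rewrite pochhammerS IHk ffactSr_natr exprS; ring.
Qed.

(* The bound on nu keeps the coefficients out of reach of the boundary
   term in I P_0 = P_1 + P_0. *)
Lemma legendre_iter_low0 nu n j :
  (nu <= n + (0 < j))%N -> (forall k, (j + 2 * k)%N <> (n + nu)%N) ->
  legendre_iter R nu n j = 0.
Proof.
elim: nu n => [|nu IHnu] n le_nu njk.
  rewrite /legendre_iter /=; case: eqP => // jn.
  by case: (njk 0%N); lia.
case: n le_nu njk => [|n] le_nu njk.
  have nu0 : nu = 0%N by lia.
  rewrite legendre_iterS0 nu0 /legendre_iter /=.
  have /eqP/negPf -> : j <> 1%N by have := njk 0%N; lia.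
  have /eqP/negPf -> : j <> 0%N by lia.
  by rewrite addr0.
have n0 : (2 * n + 3)%:R != 0 :> R by rewrite pnatr_eq0 addn3.
apply: (mulfI n0); rewrite legendre_iterSS mulr0 !IHnu ?subr0 //;
  first [lia | move=> k; have := njk k; have := njk k.+1; lia].
Qed.

(** In the recurrence [legendre_iterSS], P_{n+2} keeps the same k and P_n lowers it by one, so the
    closed form reduces to Pascal's rule weighted by the end factors of the rising factorials. *)
Lemma legendre_iter_low nu n j k :
  (nu <= n + (0 < j))%N -> (j + 2 * k = n + nu)%N ->
  legendre_iter R nu n j
  = (-1) ^+ k * 'C(nu, k)%:R * (2 * j + 1)%:R
    / (2 ^+ nu.+1 * pochhammer ((n%:R + j%:R - nu%:R + 1) / 2) nu.+1).
Proof.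
elim: nu n k => [|nu IHnu] n k le_nu jk.
  rewrite /legendre_iter /=; case: k jk => [|k] jk.
    have -> : j = n by lia.
    rewrite eqxx bin0 expr0 pochhammerS /pochhammer big_ord0.
    by rewrite /=; field; have := ler0n R n; lra.
  by rewrite bin0n mulr0 !mul0r; case: eqP => //; lia.
case: n le_nu jk => [|n] le_nu jk.
  (* For n = 0 the bound admits a single primitive and forces 0 < j, and then the parity relation
     leaves only the P_1 part of I P_0. *)
  have nu0 : nu = 0%N by lia.
  have j1 : j = 1%N by lia.
  have k0 : k = 0%N by lia.
  rewrite legendre_iterS0 nu0 j1 k0 /legendre_iter /= bin0 2!pochhammerS.
  by rewrite /pochhammer big_ord0; field.
have n0 : (2 * n + 3)%:R != 0 :> R by rewrite pnatr_eq0 addn3.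
apply: (mulfI n0); rewrite legendre_iterSS.
set c : R := (n%:R + j%:R - nu%:R + 1) / 2.
have c0 : 0 < c.
  suff : nu%:R < n%:R + j%:R + 1 :> R by rewrite /c; lra.
  by rewrite -natrD natr1 ltr_nat; lia.
have X0 := pochhammer_gt0 nu (ltr_pwDl c0 ler01).
have nu0 := ler0n R nu.
have -> : (n.+1%:R + j%:R - nu.+1%:R + 1) / 2 = c by rewrite /c; field.
rewrite (IHnu n.+2 k); [|lia|lia].
have -> : (n.+2%:R + j%:R - nu%:R + 1) / 2 = c + 1 by rewrite /c; field.
rewrite (pochhammerS (c + 1)) (pochhammerSl c nu.+1) (pochhammerS (c + 1)).
have e0 := exp2_natr_neq0 R nu.
case: k jk => [|k] jk.
  (* For k = 0, j is the top degree n + nu + 2, which I^nu P_n does not reach. *)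
  rewrite legendre_iter_low0; [|lia|lia].
  have -> : (2 * n + 3)%:R = 2 * c.
    by rewrite /c (_ : j = n + nu + 2)%N; [field|lia].
  rewrite !bin0 expr0 !exprS.
  by field; rewrite e0 (gt_eqF X0) (gt_eqF c0) /=; lra.
rewrite (IHnu n k); [|lia|lia].
rewrite -/c (pochhammerSl c) binS (natrD _ 'C(_, _)).
have kj : k%:R + j%:R = n%:R + nu%:R - k%:R :> R.
  by rewrite -!natrD -natrB; [congr _%:R; lia|lia].
have cE : c = n%:R + 1 / 2 - k%:R by rewrite /c; lra.
(* Both binomials of Pascal's rule become multiples of the same one, which leaves a rational
   identity. For nu < k both sides are 0. *)
have -> : 'C(nu, k.+1)%:R = 'C(nu, k)%:R * (nu%:R - k%:R) / (k%:R + 1) :> R.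
  have k0 : k%:R + 1 != 0 :> R by rewrite natr1 pnatr_eq0.
  apply: (mulIf k0); rewrite divfK // natr1 -natrM mulnC mul_bin_left natrM.
  have [kn|nk] := leqP k nu; first by rewrite natrB // mulrC.
  by rewrite bin_small // mulr0 mul0r.
have k0 := ler0n R k.
have -> : (2 * n + 3)%:R = 2 * c + 2 * k%:R + 2.
  by rewrite cE natrD natrM; field.
rewrite !exprS; field.
by rewrite e0 (gt_eqF X0) (gt_eqF c0) /=; apply/andP; split; lra.
Qed.

(** These are the Legendre coordinates of (x + 1)^nu / nu!, the nu-fold primitive of P_0. *)
Lemma legendre_iter0 nu j :
  legendre_iter R nu 0 j
  = (2 * j + 1)%:R * 2 ^+ nu * (nu ^_ j)%:R / (nu + j).+1`!%:R.
Proof.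
elim: nu j => [|nu IHnu] j.
  rewrite /legendre_iter /= ffact0n; case: j => [|j] /=.
    by rewrite muln0 !add0n factS fact0 muln1 expr0 !mul1r invr1.
  by rewrite mulr0 mul0r.
rewrite /legendre_iter iterS -/(legendre_iter R nu 0) /legendre_primitive.
have f0 := fact_natr_neq0 R; have nu0 := ler0n R nu.
case: j => [|j] /=; rewrite !IHnu ?muln0 ?add0n.
  rewrite !addn0 !addn1 ffactn1 !ffactn0 !factS !natrM exprS.
  by field; rewrite f0 /=; apply/andP; split; lra.
have j0 := ler0n R j.
rewrite ffactSS !ffactSr_natr !addnS addSn !factS !natrM exprS.
by field; rewrite f0 /=; do ?[apply/andP; split]; lra.
Qed.

(** The recurrence is solved upwards in n, starting from the powers of x + 1. It only ever raises
    nu, so j < nu is preserved. *)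
Lemma legendre_iter_high n nu j : (j < nu)%N ->
  legendre_iter R nu n j
  = (-1) ^+ n * (2 * j + 1)%:R * nu`!%:R * 2 ^+ (2 * n + nu)
    * pochhammer ((- j%:R - n%:R + nu%:R + 1) / 2) (j + n)
    * pochhammer ((j%:R - n%:R + nu%:R + 2) / 2) n
    / ((j + n + nu)`!%:R * (n + nu + 1 - j)`!%:R
       * pochhammer ((- j%:R + n%:R + nu%:R + 3) / 2) j).
Proof.
move=> jnu; have f0 := fact_natr_neq0 R; have j0 := ler0n R j.
have e0 := exp2_natr_neq0 R.
pose a nu n := legendre_iter R nu n j.
pose h nu n : R :=  (-1) ^+ n * (2 * j + 1)%:R * nu`!%:R * 2 ^+ (2 * n + nu)
    * pochhammer ((- j%:R - n%:R + nu%:R + 1) / 2) (j + n)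
    * pochhammer ((j%:R - n%:R + nu%:R + 2) / 2) n
    / ((j + n + nu)`!%:R * (n + nu + 1 - j)`!%:R
       * pochhammer ((- j%:R + n%:R + nu%:R + 3) / 2) j).
have shift (z : R) N : 0 < z ->
    pochhammer z N = z * pochhammer (z + 1) N / (z + N%:R).
  move=> z0; have N0 := ler0n R N.
  by rewrite -pochhammerSl pochhammerS mulfK //; lra.
have a0 mu : a (j + mu.+1)%N 0%N
    = (2 * j + 1)%:R * 2 ^+ (j + mu.+1) * (j + mu.+1)`!%:R
      / (mu.+1`!%:R * (j + mu.+1 + j).+1`!%:R).
  rewrite /a legendre_iter0 -(@ffact_fact (j + mu.+1) j) ?leq_addr //.
  rewrite (_ : j + mu.+1 - j = mu.+1)%N; last by lia.
  by rewrite natrM; field; rewrite !f0.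
(* Writing nu as j + mu + 1 removes the truncated subtraction. Two consecutive values of n are
   carried along, since the recurrence has order two. *)
suff : forall mu, a (j + mu.+1)%N n = h (j + mu.+1)%N n.
  by move=> /(_ (nu - j.+1)%N); rewrite addnS -addSn subnKC.
suff : (forall mu, a (j + mu.+1)%N n = h (j + mu.+1)%N n)
    /\ (forall mu, a (j + mu.+1)%N n.+1 = h (j + mu.+1)%N n.+1) by case.
elim: n => [|n [IHn IHSn]].
  split=> mu; have mu0 := ler0n R mu.
    rewrite a0 /h muln0 addn0 add0n expr0.
    rewrite [pochhammer _ 0]big_ord0.
    set z : R := (- j%:R - 0 + _ + 1) / 2.
    have zE : z = (mu%:R + 2) / 2 by rewrite /z natrD -natr1; field.
    have -> : (- j%:R + 0 + (j + mu.+1)%:R + 3) / 2 = z + 1 by rewrite /z; field.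
    have z0 : 0 < z by rewrite zE; lra.
    rewrite shift //.
    have := pochhammer_gt0 j (ltr_pwDl z0 ler01).
    move: (pochhammer (z + 1) j) => P P0.
    rewrite (_ : 0 + (j + mu.+1) + 1 - j = mu.+2)%N; last by lia.
    rewrite (_ : (j + (j + mu.+1)) = (j + mu.+1 + j))%N; last by lia.
    rewrite !factS !natrM zE; field.
    by rewrite !f0 (gt_eqF P0) /=; do ?[apply/andP; split]; lra.
  have -> : a (j + mu.+1)%N 1%N = a (j + mu.+2)%N 0%N - a (j + mu.+1)%N 0%N.
    by rewrite /a [(j + mu.+2)%N]addnS legendre_iterS0 addrK.
  rewrite !a0 /h [(j + 1)%N]addn1 pochhammerSl (pochhammerS _ 0).
  rewrite [pochhammer _ 0]big_ord0.
  set z : R := (- j%:R - 1 + _ + 1) / 2.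
  have zE : z = (mu%:R + 1) / 2 by rewrite /z natrD -natr1; field.
  have -> : (- j%:R + 1 + (j + mu.+1)%:R + 3) / 2 = z + 1 + 1
    by rewrite /z; field.
  have z0 : 0 < z + 1 by rewrite zE; lra.
  rewrite (shift (z + 1)) //.
  have := pochhammer_gt0 j (ltr_pwDl z0 ler01).
  move: (pochhammer (z + 1 + 1) j) => P P0.
  rewrite (_ : 1 + (j + mu.+1) + 1 - j = mu.+3)%N; last by lia.
  rewrite (_ : (j.+1 + (j + mu.+1)) = (j + mu.+1 + j).+1)%N; last by lia.
  rewrite (_ : (j + mu.+2 + j) = (j + mu.+1 + j).+1)%N; last by lia.
  rewrite (_ : (j + mu.+2) = (j + mu.+1).+1)%N; last by lia.
  rewrite (_ : 2 * 1 + (j + mu.+1) = (j + mu.+1).+2)%N; last by lia.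
  rewrite !factS !natrM !exprS zE; field.
  by rewrite !f0 (gt_eqF P0) /=; do ?[apply/andP; split]; lra.
split=> // mu; have mu0 := ler0n R mu; have n0 := ler0n R n.
have -> : a (j + mu.+1)%N n.+2
    = (2 * n + 3)%:R * a (j + mu.+2)%N n.+1 + a (j + mu.+1)%N n.
  by rewrite /a [(j + mu.+2)%N]addnS legendre_iterSS subrK.
rewrite IHSn IHn /h.
(* The bases of the rising factorials are aligned on u, v, z and their shifts by 1. As u and v may
   vanish, their products are only split; z is positive, so [shift] may divide. *)
set u : R := (- j%:R - n.+2%:R + (j + mu.+1)%:R + 1) / 2.
have uE : u = (mu%:R - n%:R) / 2 by rewrite /u natrD -!natr1; field.
have -> : (- j%:R - n.+1%:R + (j + mu.+2)%:R + 1) / 2 = u + 1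
  by rewrite /u; field.
have -> : (- j%:R - n%:R + (j + mu.+1)%:R + 1) / 2 = u + 1 by rewrite /u; field.
set v : R := (j%:R - n.+2%:R + (j + mu.+1)%:R + 2) / 2.
have vE : v = j%:R + (mu%:R - n%:R + 1) / 2 by rewrite /v natrD -!natr1; field.
have -> : (j%:R - n.+1%:R + (j + mu.+2)%:R + 2) / 2 = v + 1 by rewrite /v; field.
have -> : (j%:R - n%:R + (j + mu.+1)%:R + 2) / 2 = v + 1 by rewrite /v; field.
set z : R := (- j%:R + n%:R + (j + mu.+1)%:R + 3) / 2.
have zE : z = (n%:R + mu%:R + 4) / 2 by rewrite /z natrD -!natr1; field.
have -> : (- j%:R + n.+1%:R + (j + mu.+2)%:R + 3) / 2 = z + 1 by rewrite /z; field.
have -> : (- j%:R + n.+2%:R + (j + mu.+1)%:R + 3) / 2 = z + 1 by rewrite /z; field.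
have z0 : 0 < z by rewrite zE; lra.
rewrite (shift z) //.
have := pochhammer_gt0 j (ltr_pwDl z0 ler01).
move: (pochhammer (z + 1) j) => P P0.
rewrite !(addnS j) (pochhammerSl u) (pochhammerSl v) !pochhammerS.
move: (pochhammer (u + 1) (j + n)) (pochhammer (v + 1) n) => X Y.
rewrite (_ : (j + n).+1 + (j + mu).+2 = (j + n + j + mu).+3)%N; last by lia.
rewrite (_ : j + n + (j + mu).+1 = (j + n + j + mu).+1)%N; last by lia.
rewrite (_ : (j + n).+2 + (j + mu).+1 = (j + n + j + mu).+3)%N; last by lia.
rewrite (_ : n.+1 + (j + mu).+2 + 1 - j = (n + mu).+4)%N; last by lia.
rewrite (_ : n + (j + mu).+1 + 1 - j = (n + mu).+2)%N; last by lia.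
rewrite (_ : n.+2 + (j + mu).+1 + 1 - j = (n + mu).+4)%N; last by lia.
rewrite (_ : 2 * n.+1 + (j + mu).+2 = (2 * n + j + mu).+4)%N; last by lia.
rewrite (_ : 2 * n + (j + mu).+1 = (2 * n + j + mu).+1)%N; last by lia.
rewrite (_ : 2 * n.+2 + (j + mu).+1 = (2 * n + j + mu).+4.+1)%N; last by lia.
rewrite !factS !natrM !exprS uE vE zE; field.
by rewrite !f0 (gt_eqF P0) /=; do ?[apply/andP; split]; lra.
Qed.

End IteratedIntegrals.

(** * The convolution *)

Section Convolution.
Variable R : realType.
Implicit Types (n k j nu : nat) (p q : {poly R}).

(** The fundamental theorem of calculus; the sign convention frees it from any order between a and
    b, as needed for arbitrary x. *)
Lemma oriented_integral_deriv (a b : R) p :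
  oriented_integral a b (fun t => p^`().[t]) = p.[b] - p.[a].
Proof.
have FTC (c d : R) : c < d ->
    (\int[@lebesgue_measure R]_(t in `[c, d]%classic) p^`().[t] = p.[d] - p.[c])%R.
  move=> cd; rewrite /Rintegral (@continuous_FTC2 _ _ (horner p)) //.
  - by apply: continuous_subspaceT; exact: continuous_horner.
  - split=> [t _||].
    + exact: derivable_horner.
    + by apply: cvg_at_right_filter; exact: continuous_horner.
    + by apply: cvg_at_left_filter; exact: continuous_horner.
  - by move=> t _; rewrite derivE.
rewrite /oriented_integral; case: ltgtP => [ab|ba|->].
- exact: FTC.
- by rewrite FTC // opprB.
- by rewrite set_itv1 Rintegral_set1 subrr.
Qed.

Lemma deriv_comp_subX p (x : R) :
  (p \Po (x%:P - 'X))^`() = - (p^`() \Po (x%:P - 'X)).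
Proof. by rewrite deriv_comp derivB derivC derivX sub0r mulrN1. Qed.

Lemma convolution_antiderivr p (q : nat -> {poly R}) N (x : R) :
    p^`(N) = 0 ->
    (forall k, (q k.+1)^`() = q k) -> (forall k, (q k.+1).[-1] = 0) ->
  oriented_integral (-1) (x + 1) (fun t => p.[x - t] * (q 0%N).[t])
  = \sum_(k < N) p^`(k).[-1] * (q k.+1).[x + 1].
Proof.
move=> pN dq q0.
(* The outcome of N integrations by parts, taken as an explicit antiderivative. It vanishes at t =
   -1 through q, and at t = x + 1 the argument x - t is -1. *)
pose G := \sum_(k < N) (p^`(k) \Po (x%:P - 'X)) * q k.+1.
have dG : G^`() = (p \Po (x%:P - 'X)) * q 0%N.
  (* Adding the vanishing N-th term yields a telescoping identity valid for every N, hence provable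
     by induction. *)
  have -> : (p \Po (x%:P - 'X)) * q 0%N
      = (p \Po (x%:P - 'X)) * q 0%N - (p^`(N) \Po (x%:P - 'X)) * q N.
    by rewrite pN comp_poly0 mul0r subr0.
  rewrite /G raddf_sum /=; elim: {pN G} N => [|N IHN].
    by rewrite big_ord0 derivn0 subrr.
  rewrite big_ord_recr IHN /= derivM deriv_comp_subX dq -derivnS; ring.
transitivity (oriented_integral (-1) (x + 1) (fun t => G^`().[t])).
  congr oriented_integral; apply/funext => t.
  by rewrite dG hornerM horner_comp !hornerE.
rewrite oriented_integral_deriv /G !horner_sum [X in _ - X]big1 ?subr0.
  apply: eq_bigr => k _; rewrite hornerM horner_comp !hornerE.
  by congr (_.[_] * _); ring.
by move=> k _; rewrite hornerM q0 mulr0.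
Qed.

Lemma convolution_antiderivl (p : nat -> {poly R}) q N (x : R) :
    q^`(N) = 0 ->
    (forall k, (p k.+1)^`() = p k) -> (forall k, (p k.+1).[-1] = 0) ->
  oriented_integral (-1) (x + 1) (fun t => (p 0%N).[x - t] * q.[t])
  = \sum_(k < N) q^`(k).[-1] * (p k.+1).[x + 1].
Proof.
move=> qN dp p0.
(* The endpoints exchange roles: this one vanishes at t = x + 1, and t = -1 contributes the sum,
   hence the sign. *)
pose G := - \sum_(k < N) (p k.+1 \Po (x%:P - 'X)) * q^`(k).
have dG : G^`() = (p 0%N \Po (x%:P - 'X)) * q.
  have -> : (p 0%N \Po (x%:P - 'X)) * q
      = (p 0%N \Po (x%:P - 'X)) * q - (p N \Po (x%:P - 'X)) * q^`(N).
    by rewrite qN mulr0 subr0.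
  rewrite /G derivN raddf_sum /=; elim: {qN G} N => [|N IHN].
    by rewrite big_ord0 derivn0 subrr oppr0.
  rewrite big_ord_recr /= opprD IHN derivM deriv_comp_subX dp -derivnS; ring.
transitivity (oriented_integral (-1) (x + 1) (fun t => G^`().[t])).
  congr oriented_integral; apply/funext => t.
  by rewrite dG hornerM horner_comp !hornerE.
rewrite oriented_integral_deriv /G !hornerN !horner_sum big1 ?oppr0 ?sub0r.
  rewrite opprK; apply: eq_bigr => k _; rewrite hornerM horner_comp !hornerE.
  by rewrite mulrC; congr (_ * _.[_]); ring.
move=> k _; rewrite hornerM horner_comp !hornerE.
by rewrite (_ : x - (x + 1) = -1) ?p0 ?mul0r //; ring.
Qed.

Lemma derivn_legendre_eq0 n : (legendre R n)^`(n.+1) = 0.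
Proof.
rewrite /legendre derivnZ /derivn -iterD -/(derivn _ _) derivn_poly0 ?scaler0 //.
rewrite (leq_trans (size_poly_exp_leq _ _)) //.
by rewrite -[1]/(1%:P) size_XnsubC //; lia.
Qed.

Lemma poly_fun_eq0 p : (forall x, p.[x] = 0) -> p = 0.
Proof.
(* The first [size p] natural numbers are distinct roots, more than a nonzero p could have. *)
move=> p0; apply: (@roots_geq_poly_eq0 _ p [seq i%:R | i <- iota 0 (size p)]).
- by apply/allP => x _; rewrite rootE p0.
- by rewrite map_inj_uniq ?iota_uniq //; apply: mulrIn; exact: oner_neq0.
- by rewrite size_map size_iota.
Qed.

(** The N-th derivative at -1 isolates the top coefficient: by [derivn_legendre_m1] it kills P_j for
    j < N and not P_N. *)
Lemma legendre_free N (c : nat -> R) :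
  (forall x, \sum_(j < N) c j * (legendre R j).[x] = 0) ->
  forall j, (j < N)%N -> c j = 0.
Proof.
elim: N => // N IHN c0.
have P0 : \sum_(j < N.+1) c j *: legendre R j = 0.
  apply: poly_fun_eq0 => x; rewrite horner_sum -[RHS](c0 x).
  by apply: eq_bigr => j _; rewrite hornerZ.
have cN : c N = 0.
  have := congr1 (fun p => p^`(N).[-1]) P0.
  rewrite raddf_sum horner_sum big_ord_recr /= big1 ?add0r => [|j _].
    rewrite derivnZ hornerZ derivn_legendre_m1 raddf0 horner0 => /eqP.
    rewrite mulf_eq0 => /orP[/eqP //|].
    rewrite !mulf_eq0 invr_eq0 mulf_eq0 signr_eq0 (negPf (exp2_natr_neq0 _ _)).
    by rewrite (negPf (fact_natr_neq0 _ _)) pnatr_eq0 addnn mul2n ffactnn -leqn0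
      leqNgt fact_gt0.
  rewrite derivnZ hornerZ derivn_legendre_m1 ffact_small ?mulr0 ?mul0r ?mulr0 //.
  by have := ltn_ord j; lia.
move=> j; rewrite ltnS leq_eqVlt => /predU1P[-> //|]; apply: IHN => x.
by have := c0 x; rewrite big_ord_recr /= cN mul0r addr0.
Qed.

(** Padding with zero coordinates gives a range independent of nu, so that the sums over nu and j
    can be exchanged. *)
Lemma horner_legendre_antideriv nu n N x : (n + nu < N)%N ->
  (legendre_antideriv R nu n).[x]
  = \sum_(j < N) legendre_iter R nu n j * (legendre R j).[x].
Proof.
move=> nN; rewrite /legendre_antideriv horner_sum.
rewrite (big_ord_widen _ (fun j => (legendre_iter R nu n j *: legendre R j).[x]) nN).
rewrite big_mkcond; apply: eq_bigr => j _; rewrite hornerZ ltnS.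
by case: leqP => // nj; rewrite legendre_iter_eq0 ?mul0r.
Qed.

Lemma legendre_convolution_expansion m n :
  is_legendre_convolution_expansion m n
    (fun j => \sum_(k < m.+1) (legendre R m)^`(k).[-1] * legendre_iter R k.+1 n j).
Proof.
move=> x; rewrite -(legendre_antideriv0 R n).
rewrite (@convolution_antiderivr _ (fun k => legendre_antideriv R k n) m.+1);
  [|exact: derivn_legendre_eq0|by move=> k; exact: deriv_legendre_antideriv
  |by move=> k; exact: legendre_antideriv_m1].
under eq_bigr => k _.
  rewrite (@horner_legendre_antideriv _ _ (m + n + 2)); last first.
    by have := ltn_ord k; lia.
  rewrite mulr_sumr; over.
rewrite exchange_big /=; apply: eq_bigr => j _; rewrite mulr_suml.
by apply: eq_bigr => k _; rewrite mulrA.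
Qed.

Lemma legendre_convolution_expansion_sym m n :
  is_legendre_convolution_expansion m n
    (fun j => \sum_(k < n.+1) (legendre R n)^`(k).[-1] * legendre_iter R k.+1 m j).
Proof.
move=> x; rewrite -(legendre_antideriv0 R m).
rewrite (@convolution_antiderivl (fun k => legendre_antideriv R k m) _ n.+1);
  [|exact: derivn_legendre_eq0|by move=> k; exact: deriv_legendre_antideriv
  |by move=> k; exact: legendre_antideriv_m1].
under eq_bigr => k _.
  rewrite (@horner_legendre_antideriv _ _ (m + n + 2)); last first.
    by have := ltn_ord k; lia.
  rewrite mulr_sumr; over.
rewrite exchange_big /=; apply: eq_bigr => j _; rewrite mulr_suml.
by apply: eq_bigr => k _; rewrite mulrA.
Qed.

Lemma legendre_convolution_unique m n (rho rho' : nat -> R) :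
  is_legendre_convolution_expansion m n rho ->
  is_legendre_convolution_expansion m n rho' ->
  forall j, (j < m + n + 2)%N -> rho j = rho' j.
Proof.
move=> E E' j jmn; apply/eqP; rewrite -subr_eq0; apply/eqP.
apply: (@legendre_free (m + n + 2) (fun j => rho j - rho' j)) => // y.
under eq_bigr do rewrite mulrBl.
by have := E (y - 1); rewrite (E' (y - 1)) subrK sumrB => ->; rewrite subrr.
Qed.

End Convolution.

(** * Gamma at half-integers *)

Section GammaHalfIntegers.
Local Open Scope classical_set_scope.
Local Open Scope ring_scope.
Variable R : realType.
Local Notation mu := (@lebesgue_measure R).
Implicit Types (n k : nat).

(** For N = n + 1, exp(-N^2) <= exp(-N) <= (k+1)! / N^(k+1), which bounds the sequence by (k+1)! /
    N. *)
Lemma cvg_exprn_gauss k :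
  (n.+1%:R ^+ k * gauss_fun n.+1%:R) @[n --> \oo] --> (0 : R).
Proof.
apply: (@squeeze_cvgr _ _ _ _ (fun=> 0) (fun n => k.+1`!%:R * n.+1%:R^-1)).
- near=> n; have n0 : 0 < n.+1%:R :> R by [].
  rewrite mulr_ge0 ?exprn_ge0 ?expR_ge0 //= ler_pdivlMr // mulrAC -exprSr.
  rewrite /gauss_fun expRN ler_pdivrMr ?expR_gt0 //.
  rewrite -ler_pdivrMl ?ltr0n ?fact_gt0 //.
  have n1 : n.+1%:R <= n.+1%:R ^+ 2 :> R.
    by rewrite -natrX ler_nat expnS expn1 leq_pmull.
  apply: le_trans (_ : expR n.+1%:R <= _); last by rewrite ler_expR.
  apply: le_trans (expR_ge1Dxn k (ltW n0)).
  by rewrite [leLHS]mulrC lerDr.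
- exact: cvg_cst.
- rewrite -[X in _ --> X](mulr0 k.+1`!%:R); apply: cvgMr.
  exact: cvg_harmonic.
Unshelve. all: by end_near. Qed.

Lemma derivable_gauss_fun (s : R) : derivable gauss_fun s 1.
Proof.
apply/derivable1_diffP.
apply: (@differentiable_comp _ _ _ _ (fun x : R => - x ^+ 2) expR).
  by apply/derivable1_diffP/derivableN; exact: exprn_derivable.
by apply/derivable1_diffP; exact: derivable_expR.
Qed.

Lemma derive1_gauss_fun (s : R) :
  gauss_fun^`()%classic s = - (2 * s * gauss_fun s).
Proof.
rewrite (@derive1_comp _ (fun x : R => - x ^+ 2) expR); last first.
- exact: derivable_expR.
- by apply: derivableN; exact: exprn_derivable.
rewrite derive1N ?exp_derive1; last exact: exprn_derivable.
have -> : (expR^`()%classic (- s ^+ 2) = gauss_fun s)%R.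
  by rewrite /gauss_fun derive1E -[in RHS]derive_expR.
by rewrite mulrN mulrC expr1.
Qed.

Lemma continuous_exprn_gauss k : continuous (fun s : R => s ^+ k * gauss_fun s).
Proof.
move=> s; apply: cvgM; first exact: exprn_continuous.
exact: continuous_gauss_fun.
Qed.

Definition gauss_moment k (b : R) : R :=
  \int[mu]_(s in `[0, b]) (s ^+ k * gauss_fun s).

Lemma LRcontinuous_derivable (f : R -> R) (a b : R) :
  (forall s, derivable f s 1) -> derivable_oo_LRcontinuous f a b.
Proof.
move=> df; have cf s : {for s, continuous f}.
  exact/differentiable_continuous/derivable1_diffP.
by split=> [s _||]; [exact: df|exact/cvg_at_right_filter/cf
  |exact/cvg_at_left_filter/cf].
Qed.

Lemma gauss_moment1 (b : R) : 0 < b -> gauss_moment 1 b = (1 - gauss_fun b) / 2.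
Proof.
move=> b0; rewrite /gauss_moment /Rintegral.
rewrite (@continuous_FTC2 _ _ (fun s => - 2^-1 * gauss_fun s)) //=.
- by rewrite /gauss_fun expr0n /= oppr0 expR0; field.
- by apply: continuous_subspaceT; exact: continuous_exprn_gauss.
- by apply: LRcontinuous_derivable => s; apply: derivableM => //;
    exact: derivable_gauss_fun.
- move=> s _; rewrite derive1Ml ?derive1_gauss_fun; last exact: derivable_gauss_fun.
  by field.
Qed.

(** Integration by parts, with s exp(-s^2) as the derivative of -exp(-s^2) / 2. *)
Lemma gauss_momentSS k (b : R) : 0 < b ->
  gauss_moment k.+2 b
  = k.+1%:R / 2 * gauss_moment k b - b ^+ k.+1 * gauss_fun b / 2.
Proof.
move=> b0; rewrite /gauss_moment.
transitivity (\int[mu]_(s in `[0, b]) (s ^+ k.+1 * (s ^+ 1 * gauss_fun s))).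
  by apply: eq_Rintegral => s _; rewrite mulrA -exprD addn1.
rewrite (@Rintegration_by_parts _ (fun s => s ^+ k.+1)
   (fun s => - 2^-1 * gauss_fun s) (fun s => k.+1%:R * s ^+ k)
   (fun s => s ^+ 1 * gauss_fun s)) //.
- rewrite expr0n /= mul0r subr0.
  transitivity (b ^+ k.+1 * (- 2^-1 * gauss_fun b)
      - (- (k.+1%:R / 2)) * \int[mu]_(s in `[0, b]) (s ^+ k * gauss_fun s)).
    rewrite -RintegralZl //; last first.
      apply: continuous_compact_integrable; first exact: segment_compact.
      by apply: continuous_subspaceT; exact: continuous_exprn_gauss.
    by congr (_ - _); apply: eq_Rintegral => s _; ring.
  by ring.
- apply: continuous_subspaceT => s; apply: cvgM; first exact: cvg_cst.
  exact: exprn_continuous.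
- by apply: LRcontinuous_derivable => s; exact: exprn_derivable.
- by move=> s _; rewrite exp_derive1.
- by apply: continuous_subspaceT; exact: continuous_exprn_gauss.
- by apply: LRcontinuous_derivable => s; apply: derivableM => //;
    exact: derivable_gauss_fun.
- move=> s _; rewrite derive1Ml ?derive1_gauss_fun; last exact: derivable_gauss_fun.
  by field.
Qed.

(** The moments over the whole half-line, that is Gamma((k+1)/2) / 2, given by the limit of the
    recurrence [gauss_momentSS]. *)
Fixpoint gauss_moment_lim k : R :=
  match k with
  | 0 => Num.sqrt pi / 2
  | 1 => 1 / 2
  | k'.+2 => k'.+1%:R / 2 * gauss_moment_lim k'
  end.

Lemma cvg_gauss_moment k :
  gauss_moment k n.+1%:R @[n --> \oo] --> gauss_moment_lim k.
Proof.
suff : (gauss_moment k n.+1%:R @[n --> \oo] --> gauss_moment_lim k) /\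
  (gauss_moment k.+1 n.+1%:R @[n --> \oo] --> gauss_moment_lim k.+1) by case.
elim: k => [|k [IHk IHSk]]; split => //.
- have := @ge0_cvgn_integral R mu _ (@gauss_fun_ge0 R) (@measurable_gauss_fun R).
  rewrite integral0y_gauss -cvg_shiftS /= => /fine_cvg; set g := _ \o _.
  rewrite (_ : (fun n => gauss_moment 0 n.+1%:R) = g) //.
  apply/funext => n; rewrite /gauss_moment /Rintegral /g /=.
  by congr fine; apply: eq_integral => s _; rewrite mul1r.
- under eq_fun do rewrite gauss_moment1 //.
  rewrite /= -[X in X / 2]subr0; apply: cvgMl; apply: cvgB; first exact: cvg_cst.
  rewrite [X in X @ _](_ : _ = (fun n => n.+1%:R ^+ 0 * gauss_fun n.+1%:R)).
    exact: cvg_exprn_gauss.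
  by apply/funext => n; rewrite mul1r.
- under eq_fun do rewrite gauss_momentSS //.
  have -> : gauss_moment_lim k.+2 = k.+1%:R / 2 * gauss_moment_lim k - 0 / 2.
    by rewrite mul0r subr0.
  apply: cvgB; first by apply: cvgMr.
  by apply: cvgMl; exact: cvg_exprn_gauss.
Qed.

(* Substituting t = s^2; with k >= 0 the integrand is continuous at 0. *)
Lemma Gamma_half k : Gamma (k.+2%:R / 2 : R) = 2 * gauss_moment_lim k.+1.
Proof.
pose f (t : R) := Num.sqrt t ^+ k * expR (- t).
have cf : continuous f.
  move=> t; apply: cvgM.
    apply: (@continuous_comp _ _ _ Num.sqrt (fun u => u ^+ k)).
      exact: sqrt_continuous.
    exact: exprn_continuous.
  apply: (@continuous_comp _ _ _ -%R expR); last exact: continuous_expR.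
  by apply: continuousN; exact: cvg_id.
have f0 t : 0 <= f t by rewrite mulr_ge0 ?expR_ge0 // exprn_ge0 ?sqrtr_ge0.
have mf : measurable_fun [set: R] f by exact: continuous_measurable_fun.
(* The upper end is a square, so that after the substitution the interval is [0, n + 1]. *)
have sub n : (\int[mu]_(t in `[0%R, (n.+1 ^ 2)%:R]) (f t)%:E
    = (2 * gauss_moment k.+1 n.+1%:R)%:E)%E.
  have n0 : 0 <= n.+1%:R :> R by [].
  have d2 (s : R) : (fun u : R => u ^+ 2)^`()%classic s = 2 * s.
    by rewrite exp_derive1 expr1.
  have c2 (s : R) : {for s, continuous (fun u : R => u ^+ 2)^`()%classic}.
    by rewrite (funext d2); apply: cvgMr; exact: cvg_id.
  have := @integration_by_substitution_increasing R (fun s => s ^+ 2) f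
    0 n.+1%:R n0.
  rewrite /= expr0n natrX => ->; first last.
  - by apply: continuous_subspaceT => t; exact: cf.
  - by apply: LRcontinuous_derivable => s; exact: exprn_derivable.
  - by apply/cvg_ex; exists (2 * n.+1%:R); apply: cvg_at_left_filter;
      rewrite -d2; exact: c2.
  - by apply/cvg_ex; exists (2 * 0); apply: cvg_at_right_filter;
      rewrite -d2; exact: c2.
  - by move=> s _; exact: c2.
  - move=> s t; rewrite !in_itv /= => /andP[s0 _] /andP[t0 _] st.
    by rewrite ltr_pXn2r ?nnegrE.
  transitivity (\int[mu]_(s in `[0%R, n.+1%:R])
      (2%:E * (s ^+ k.+1 * gauss_fun s)%:E))%E.
    apply: eq_integral => s; rewrite inE /= in_itv /= => /andP[s0 _].
    rewrite -EFinM; congr EFin; rewrite fctE /= d2 /f /gauss_fun sqrtr_sqr ger0_norm //.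
    by rewrite (exprSr s k); ring.
  have int : mu.-integrable `[0, n.+1%:R] (EFin \o (fun s => s ^+ k.+1 * gauss_fun s)).
    apply: continuous_compact_integrable; first exact: segment_compact.
    by apply: continuous_subspaceT; exact: continuous_exprn_gauss.
  rewrite integralZl // /gauss_moment /Rintegral EFinM fineK //.
  exact: integrable_fin_num.
have int0y : (\int[mu]_(t in `[0%R, +oo[) (f t)%:E
    = (2 * gauss_moment_lim k.+1)%:E)%E.
  (* The integrand is nonnegative, so the half-line may be exhausted along the squares. *)
  have sq : (n.+1 ^ 2)%N @[n --> \oo] --> \oo.
    apply/cvgnyPge => A; near=> n.
    have : (A <= n)%N by near: n; exact: nbhs_infty_ge.
    by rewrite expnS expn1; lia.
  have := cvg_comp _ _ sq (@ge0_cvgn_integral R mu _ f0 mf).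
  rewrite [X in X @ _](_ : _ = fun n => (2 * gauss_moment k.+1 n.+1%:R)%:E); last first.
    by apply/funext => n; exact: sub.
  move=> /cvg_lim <- //; apply: cvg_lim => //.
  by apply/fine_cvgP; split; [by near=> n|apply: cvgMr; exact: cvg_gauss_moment].
rewrite /Gamma.
transitivity (fine (\int[mu]_(t in `]0%R, +oo[) (f t)%:E)%E).
  apply: eq_Rintegral => t; rewrite inE /= in_itv /= andbT => t0.
  rewrite /f -(powR12_sqrt (ltW t0)) -powR_mulrn ?powR_ge0 // -powRrM.
  by congr (_ `^ _ * _); rewrite -!natr1; field.
rewrite integral_itv_obnd_cbnd ?int0y //.
by apply: measurableT_comp => //; exact: measurable_funTS.
Unshelve. all: by end_near. Qed.

(** Legendre's duplication formula at z = (k+2)/2. Passing from k to k + 1 replaces one factor by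
    the value one unit further, which costs the factor (k+2)/2. *)
Lemma Gamma_duplication k :
  Gamma (k.+2%:R / 2 : R) * Gamma (k.+3%:R / 2)
  = Num.sqrt pi * k.+1`!%:R / 2 ^+ k.+1.
Proof.
rewrite !Gamma_half; elim: k => [|k IHk].
  by rewrite /= factS fact0 muln1 expr1; field.
transitivity (k.+2%:R / 2 * (2 * gauss_moment_lim k.+1 * (2 * gauss_moment_lim k.+2))).
  rewrite (_ : gauss_moment_lim k.+3 = k.+2%:R / 2 * gauss_moment_lim k.+1) //.
  by ring.
by rewrite IHk (factS k.+1) natrM (exprS _ k.+1); field; exact: exp2_natr_neq0.
Qed.

End GammaHalfIntegers.

(** * Identification of the coefficients *)

Section Coefficients.
Variable R : realType.
Implicit Types (m n k j nu : nat).

Lemma Gamma_half_add k j :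
  Gamma ((k + 2 * j).+2%:R / 2 : R)
  = pochhammer (k.+2%:R / 2) j * Gamma (k.+2%:R / 2).
Proof.
elim: j => [|j IHj].
  by rewrite muln0 addn0 /pochhammer big_ord0 mul1r.
rewrite pochhammerS mulrAC -IHj (_ : k + 2 * j.+1 = (k + 2 * j).+2)%N; last by lia.
rewrite !Gamma_half.
rewrite (_ : gauss_moment_lim R (k + 2 * j).+3
  = (k + 2 * j).+2%:R / 2 * gauss_moment_lim R (k + 2 * j).+1) //.
by field.
Qed.

Lemma derivn_legendre_m1_fact n k : (k <= n)%N ->
  (legendre R n)^`(k).[-1]
  = (-1) ^+ (n + k) * (n + k)`!%:R / (2 ^+ k * k`!%:R * (n - k)`!%:R).
Proof.
move=> kn; rewrite derivn_legendre_m1.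
rewrite -(@ffact_fact (n + k) (2 * k)); last by lia.
rewrite (_ : n + k - 2 * k = n - k)%N; last by lia.
by rewrite natrM; field; rewrite !fact_natr_neq0 exp2_natr_neq0.
Qed.

(** Each primitive moves the index by at most one. In the closed form, j > n + nu exceeds the
    degree, and j < n - nu makes k > nu, so the binomial vanishes. *)
Lemma legendre_iter_far nu n j :
  (nu <= n + (0 < j))%N -> (nu < `|j - n|)%N -> legendre_iter R nu n j = 0.
Proof.
move=> le_nu far; case: (boolP ((j <= n + nu) && ~~ odd (n + nu - j))%N).
  move=> /andP[jn even]; set k := (n + nu - j)./2.
  have jk : (j + 2 * k = n + nu)%N by rewrite /k; lia.
  by rewrite (legendre_iter_low _ le_nu jk) bin_small ?mulr0 ?mul0r //; lia.
by move=> H; apply: legendre_iter_low0 => // k jk; move: H; lia.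
Qed.

(** The power 4^nu collects 2^(nu-1) from the derivative at -1 and 2^(nu+1) from the iterated
    primitive; j <= n + nu keeps the subtraction in [varpi] exact. *)
Lemma varpiE m n j nu :
  (0 < nu <= m + 1)%N -> (nu <= n + (0 < j))%N -> (j <= n + nu)%N ->
  varpi R m n j nu = (legendre R m)^`(nu.-1).[-1] * legendre_iter R nu n j.
Proof.
case: nu => // k; rewrite addn1 ltnS -pred_Sn => /andP[_ km] le_nu jn.
rewrite /varpi; case: ifPn => [odd_nj|even].
  rewrite legendre_iter_low0 ?mulr0 // => i.
  by move: odd_nj; lia.
set i := (_./2); have ji : (j + 2 * i = n + k.+1)%N by rewrite /i; lia.
rewrite (legendre_iter_low _ le_nu ji) derivn_legendre_m1_fact //.
rewrite pochhammerNn (_ : m + k.+1 + 1 = (m + k).+2)%N; last by lia.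
rewrite (_ : m + k.+1 - 1 = m + k)%N; last by lia.
rewrite (_ : k.+1 - 1 = k)%N; last by lia.
rewrite (_ : m + 1 - k.+1 = m - k)%N; last by lia.
have c0 : 0 < (n%:R + j%:R - k.+1%:R + 1) / 2 :> R.
  suff : k.+1%:R < n%:R + j%:R + 1 :> R by lra.
  by rewrite -natrD natr1 ltr_nat; lia.
have := pochhammer_gt0 k.+2 c0; rewrite (addn1 k.+1).
move: (pochhammer _ k.+2) => P P0.
rewrite (_ : 4 = 2 * 2 :> R) ?exprMn; last by ring.
rewrite !(exprS 2) 2!(exprS (-1)); field.
by rewrite !fact_natr_neq0 exp2_natr_neq0 (gt_eqF P0).
Qed.

Lemma dcoefE m n j nu :
  (j < nu <= n + 1)%N -> (j <= m)%N ->
  dcoef R m n j nu = (legendre R n)^`(nu.-1).[-1] * legendre_iter R nu m j.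
Proof.
case: nu => // k; rewrite addn1 ltnS [(_ < n.+1)%N]ltnS -pred_Sn => /andP[jk kn] jm.
rewrite derivn_legendre_m1_fact // legendre_iter_high // /dcoef.
have e0 := exp2_natr_neq0 R; have f0 := fact_natr_neq0 R.
have mE : m%:R = (m - j)%:R + j%:R :> R by rewrite -natrD subnK.
have -> : (- j%:R + m%:R + k.+1%:R + 2) / 2 = (m - j + k.+1).+2%:R / 2 :> R.
  by rewrite mE; field.
have -> : (j%:R + m%:R + k.+1%:R + 3) / 2
    = (m - j + k.+2 + 2 * j).+2%:R / 2 :> R.
  by rewrite mE; field.
(* Lowering the second Gamma argument by j leaves the pair of the duplication formula with K = m - j
   + nu, times the rising factorial already present in [legendre_iter_high]. *)
rewrite Gamma_half_add (_ : m - j + k.+2 = (m - j + k.+1).+1)%N; last by rewrite -addnS.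
have -> : (- j%:R + m%:R + k.+1%:R + 3) / 2 = (m - j + k.+1).+3%:R / 2 :> R.
  by rewrite mE; field.
rewrite (_ : m + k.+1 + 1 - j = (m - j + k.+1).+1)%N; last by lia.
set K := (m - j + k.+1)%N; have := Gamma_duplication R K.
have := @pochhammer_gt0 R (K.+3%:R / 2) j.
move: (Gamma _) (Gamma _) (pochhammer (K.+3%:R / 2) j) => G' G Z Z0 GG.
move: (pochhammer _ (j + m)) (pochhammer _ m) => X Y.
have Zgt0 : 0 < Z by apply: Z0; rewrite divr_gt0.
have sp0 : Num.sqrt pi != 0 :> R by rewrite gt_eqF // sqrtr_gt0 pi_gt0.
rewrite (_ : _ * G * _ = (n + 1 - k.+1)`!%:R * (j + m + k.+1)`!%:R
  * Z * (Num.sqrt pi * K.+1`!%:R / 2 ^+ K.+1)); last by rewrite -GG; ring.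
(* The possibly negative exponent becomes a quotient whose denominator also occurs in the
   duplication formula. *)
have -> : 2 ^ (j%:Z + m%:Z - k.+1%:Z) = 2 ^+ (2 * m + 1) / 2 ^+ K.+1 :> R.
  apply: (mulIf (e0 K.+1)); rewrite divfK // !exprnP -expfzDr ?pnatr_eq0 //.
  by congr (_ ^ _); rewrite /K; lia.
rewrite (_ : n + 1 - k.+1 = n - k)%N; last by lia.
rewrite (_ : n + k.+1 - 1 = n + k)%N; last by lia.
rewrite (_ : m + k.+1 + n + 1 = (n + k + m).+2)%N; last by lia.
rewrite (_ : 2 * m + k.+1 = 2 * m + 1 + k)%N; last by lia.
rewrite (factS k) natrM !exprS !exprD expr1; field.
by rewrite sp0 !f0 !e0 (gt_eqF Zgt0).
Qed.

End Coefficients.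

Theorem corollary3p10 (R : realType) (m n : nat)
    (hm : (0 < m)%N) (hn : (0 < n)%N) (hmn : (m <= n)%N) :
  (exists rho : nat -> R, is_legendre_convolution_expansion m n rho) /\
  (forall rho : nat -> R, is_legendre_convolution_expansion m n rho ->
    [/\ (forall j : nat,
           (maxn (m + 1) (n - m - 1) <= j)%N -> (j <= m + n + 1)%N ->
           rho j = \sum_(maxn 1 `|j - n|%N <= nu < m + 2) varpi R m n j nu),
        ((2 * m + 3 <= n)%N -> forall j : nat,
           (m + 1 <= j)%N -> (j <= n - m - 2)%N -> rho j = 0)
      & (forall j : nat, (j <= m)%N ->
           rho j = \sum_(1 <= nu < j + 1) varpi R n m j nu
                   + \sum_(j + 1 <= nu < n + 2) dcoef R m n j nu)]).
Proof.
split; first by eexists; exact: legendre_convolution_expansion.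
move=> rho rhoE.
(* By uniqueness, the given coefficients equal those of both explicit expansions. *)
have rho1 j : (j < m + n + 2)%N -> rho j
    = \sum_(1 <= nu < m + 2) (legendre R m)^`(nu.-1).[-1] * legendre_iter R nu n j.
  move=> jmn; rewrite addn2 big_add1 big_mkord.
  by rewrite (legendre_convolution_unique rhoE (legendre_convolution_expansion m n)).
have rho2 j : (j < m + n + 2)%N -> rho j
    = \sum_(1 <= nu < n + 2) (legendre R n)^`(nu.-1).[-1] * legendre_iter R nu m j.
  move=> jmn; rewrite addn2 big_add1 big_mkord.
  by rewrite (legendre_convolution_unique rhoE (legendre_convolution_expansion_sym m n)).
split=> [j mj jmn|nm j mj jn|j jm].
- rewrite rho1; last by lia.
  (* Terms with nu < |j - n| vanish. For the others nu <= m + 1 <= n + 1 and 0 < j, which is just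
     what [varpiE] allows. *)
  rewrite (@big_cat_nat _ _ _ (maxn 1 `|j - n|%N)) /=; [|lia|lia].
  rewrite big_nat big1 ?add0r => [|nu nuP].
    by apply: eq_big_nat => nu nuP; rewrite varpiE //; lia.
  by rewrite legendre_iter_far ?mulr0 //; lia.
- rewrite rho1; last by lia.
  rewrite big_nat big1 // => nu nuP.
  (* Here |j - n| >= m + 2 exceeds every nu of the sum. *)
  by rewrite legendre_iter_far ?mulr0 //; lia.
- rewrite rho2; last by lia.
  (* The primitives now act on P_m: for nu <= j <= m the first closed form applies, and for nu > j
     the second. *)
  rewrite (@big_cat_nat _ _ _ (j + 1)) /=; [|lia|lia].
  congr (_ + _); apply: eq_big_nat => nu nuP.
    by rewrite varpiE //; lia.
  by rewrite dcoefE //; lia.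
Qed.
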